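(* There are no minimal generating sets of the semigroup $F_{\mathbb{N}}$. That is, there is no subset $G\subseteq F_{\mathbb{N}}$ with $\langle G\rangle=F_{\mathbb{N}}$ such that $\langle G'\rangle\neq F_{\mathbb{N}}$ for every proper subset $G'\subsetneq G$.
   Context: $\mathbb{N}=\{1,2,3,\ldots\}$. The zig-zag order $\preceq$ on $\mathbb{N}$ is the partial order consisting of the diagonal together with the relation $\prec$ defined, for each $n\in\mathbb{N}$, by $n\prec n+1$ if $n$ is odd and $n+1\prec n$ if $n$ is even (so $x\prec y$ holds exactly when $x$ is odd, $y$ is even and $|x-y|=1$). $F_{\mathbb{N}}$ is the semigroup, under composition, of all maps $\alpha:\mathbb{N}\to\mathbb{N}$ such that $x\preceq y$ implies $x\alpha\preceq y\alpha$. Maps are written on the right, so $x(\alpha\beta)=(x\alpha)\beta$. For $G\subseteq F_{\mathbb{N}}$, $\langle G\rangle$ denotes the subsemigroup generated by $G$, and $G$ is a generating set of $F_{\mathbb{N}}$ if $\langle G\rangle=F_{\mathbb{N}}$. Minimality is with respect to set inclusion. *)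

(* Defs.v *)
From mathcomp Require Import all_boot.
From mathcomp Require Import classical_sets.

Set Implicit Arguments.
Unset Strict Implicit.
Unset Printing Implicit Defensive.

Local Open Scope classical_set_scope.

Definition posnat := {n : nat | 0 < n}.

(* The two disjuncts are n < n + 1 for n = x odd, and n + 1 < n for n = y
   even, where < is the strict zig-zag order. *)
Definition zigzag_lt (x y : posnat) : bool :=
  (odd (val x) && (val y == (val x).+1))
  || (~~ odd (val y) && (val x == (val y).+1)).

Definition zigzag_le (x y : posnat) : bool := (x == y) || zigzag_lt x y.

Lemma zigzag_ltE x y :
  zigzag_lt x y =
  [&& odd (val x), ~~ odd (val y) &
      (val y == (val x).+1) || (val x == (val y).+1)].
Proof.
rewrite /zigzag_lt; case: x y => [x x0] [y y0] /=.
by have [->|_] := eqVneq y x.+1; have [->|_] := eqVneq x y.+1;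
  rewrite /= ?negbK; case: (odd x); case: (odd y).
Qed.

Lemma zigzag_le_refl : reflexive zigzag_le.
Proof. by move=> x; rewrite /zigzag_le eqxx. Qed.

Lemma zigzag_le_anti : antisymmetric zigzag_le.
Proof.
move=> x y /andP[/predU1P[//|xy] /predU1P[//|yx]].
move: xy yx; rewrite !zigzag_ltE => /and3P[ox _ _] /and3P[_].
by rewrite ox.
Qed.

Lemma zigzag_le_trans : transitive zigzag_le.
Proof.
move=> y x z /predU1P[->//|xy] /predU1P[<-|yz]; first by rewrite /zigzag_le xy orbT.
move: xy yz; rewrite !zigzag_ltE => /and3P[_ ey _] /andP[oy _].
by rewrite oy in ey.
Qed.

Definition FN : set (posnat -> posnat) :=
  [set a | forall x y, zigzag_le x y -> zigzag_le (a x) (a y)].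

(* Maps are written on the right in the product, so alpha beta is
   [alpha \; beta], that is, [fun x => beta (alpha x)]. *)
Definition subsemigroup (S : set (posnat -> posnat)) : Prop :=
  S `<=` FN /\ forall a b, S a -> S b -> S (a \; b).

Lemma subsemigroup_FN : subsemigroup FN.
Proof. by split=> // a b Fa Fb x y /Fa/Fb. Qed.

Definition generated (G : set (posnat -> posnat)) : set (posnat -> posnat) :=
  smallest subsemigroup G.

Definition generating_set (G : set (posnat -> posnat)) : Prop :=
  G `<=` FN /\ generated G = FN.

Definition minimal_generating_set (G : set (posnat -> posnat)) : Prop :=
  generating_set G /\ forall G', G' `<` G -> generated G' <> FN.

(* Main.v *)
(** Write a map as a lazy walk f on nat and call n - f n its delay. The delay is
    nondecreasing, and the delay of a composite is a sum of delays. Consider the walks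
    that eventually climb with at most two consecutive rests, whose delay is unbounded
    but grows logarithmically: if a product is such a walk, so is one of its factors,
    hence every generating set G contains such a walk g. Performing every other rest
    of g first and the remaining ones afterwards gives g = u v, where g lags unboundedly
    behind both u and v. A multiple x g y lags at least as much as g up to a constant,
    so neither u nor v is a multiple of g. Both are therefore products of elements of
    G \ {g}, and so is g, which makes g redundant in G. *)

Require Import Defs.
From mathcomp Require Import all_boot.
From mathcomp Require Import classical_sets.
From mathcomp Require Import boolp zify.

Set Implicit Arguments.
Unset Strict Implicit.
Unset Printing Implicit Defensive.

Local Open Scope classical_set_scope.

(** * Lazy walks on [nat] and their growth conditions *)

Definition lipschitz (f : nat -> nat) :=
  forall n, f n.+1 <= (f n).+1 /\ f n <= (f n.+1).+1.

(* Endomorphisms of the zig-zag order, with positions and values shifted down by 1. *)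
Definition zigzag_walk (f : nat -> nat) :=
  lipschitz f /\ forall n, f n.+1 <> f n -> odd (f n) = odd n.

Definition climbing (f : nat -> nat) :=
  exists N, forall n, N <= n -> f n <= f n.+1 /\ f n < f (n + 3).

(* The last inequality is [n - f n <= m - f m + C] without subtraction. *)
Definition slow (f : nat -> nat) :=
  forall k, exists C, forall m n, n <= k * m + k -> n + f m <= m + f n + C.

Definition lagging (f : nat -> nat) := forall C, exists n, f n + C < n.

Section Lipschitz.
Variable f : nat -> nat.
Hypothesis lf : lipschitz f.

Lemma lipschitz_le m n : m <= n -> f n + m <= f m + n /\ f m + m <= f n + n.
Proof.
elim: n => [|n IH] mn; first by have -> : m = 0 by lia.
have [->|mn'] : m = n.+1 \/ m <= n by lia.
  lia.
have [h1 h2] := lf n; have := IH mn'; lia.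
Qed.

Lemma lipschitz_ivt m n c : m <= n -> f m <= c <= f n ->
  exists2 x, m <= x <= n & f x = c.
Proof.
elim: n => [|n IH] mn fc.
  have m0 : m = 0 by lia.
  by rewrite m0 in fc *; exists 0; lia.
have [E|mn'] : m = n.+1 \/ m <= n by lia.
  by rewrite E in fc *; exists n.+1; lia.
have [h1 h2] := lf n.
have [h|h] : c <= f n \/ f n.+1 = c by lia.
  by have [||x ? ?] := IH; [lia|lia|exists x => //; lia].
by exists n.+1 => //; lia.
Qed.

End Lipschitz.

Lemma climbing_lower f : climbing f -> exists c, forall n, n <= 3 * f n + c.
Proof.
move=> [N Nf]; exists (N + 2) => n.
elim/ltn_ind: n => n IH.
have [h|h] := leqP n (N + 2); first by lia.
have [_] := Nf (n - 3) ltac:(lia).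
rewrite subnK; last by lia.
have := IH (n - 3) ltac:(lia); lia.
Qed.

Lemma climbing_le f N : (forall n, N <= n -> f n <= f n.+1 /\ f n < f (n + 3)) ->
  forall m n, N <= m <= n -> f m <= f n.
Proof.
move=> Nf m; elim=> [|n IH] mn; first by have -> : m = 0 by lia.
have [->//|mn'] : m = n.+1 \/ m <= n by lia.
by have [] := Nf n ltac:(lia); have := IH ltac:(lia); lia.
Qed.

Lemma climbing_quasi_le f : lipschitz f -> climbing f ->
  exists C, forall m n, m <= n -> f m <= f n + C.
Proof.
move=> lf [N Nf]; exists (f 0 + N) => m n mn.
have [h|h] := leqP N m; first by have := climbing_le Nf (m := m) (n := n); lia.
have := lipschitz_le lf (leq0n m); lia.
Qed.

(** * Passing growth conditions from a product to its factors *)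

Section Factors.
Variables f g : nat -> nat.
Hypotheses (lf : lipschitz f) (lg : lipschitz g).

Lemma climbing_factors : climbing (g \o f) -> climbing f /\ climbing g.
Proof.
move=> cgf; have [c hc] := climbing_lower cgf.
have [N Nh] := cgf; rewrite /= in Nh hc.
have hmon := climbing_le (f := g \o f) Nh; rewrite /= in hmon.
have gle z : g z <= z + g 0 by have := lipschitz_le lg (leq0n z); lia.
have fbig y : exists2 n, y <= n & y <= f n.
  exists (y + 3 * (y + g 0) + c); first by lia.
  have := hc (y + 3 * (y + g 0) + c).
  have := gle (f (y + 3 * (y + g 0) + c)); lia.
(* A descent of f from x must be undone later, and g \o f is constant on this excursion,
   so it lasts two steps; then f has no value left for the step before or after it. *)
have fmon x : N.+1 <= x -> f x <= f x.+1.
  move=> Nx; have [//|down] := leqP (f x) (f x.+1).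
  have [n nx fn] := fbig (x + f x + 2).
  have [y yP fy] := lipschitz_ivt lf (m := x.+1) (n := n) (c := f x)
    ltac:(lia) ltac:(lia).
  have fx1 : f x = (f x.+1).+1 by have := lf x; lia.
  have y2 : y = x.+2.
    have [//|h] : y = x.+2 \/ x + 3 <= y.
      have : y <> x.+1 by move=> E; rewrite E in fy; lia.
      lia.
    have [_ h1] := Nh x ltac:(lia).
    by have := hmon (x + 3) y ltac:(lia); rewrite fy; lia.
  rewrite {}y2 in yP fy.
  have [h1 h1'] := Nh x ltac:(lia).
  have [h2 _] := Nh x.+1 ltac:(lia).
  have [h3 _] := Nh x.+2 ltac:(lia).
  have [h0 h0'] := Nh x.-1 ltac:(lia).
  have e0 : x.-1 + 3 = x.+2 by lia.
  have e1 : x + 3 = x.+3 by lia.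
  have e2 : x.-1.+1 = x by lia.
  rewrite e0 in h0'; rewrite e1 in h1'; rewrite e2 in h0.
  have := lf x.-1; have := lf x.+2; rewrite e2 => l2 l0.
  rewrite fy in h2 h3 h0' l2.
  have gE : g (f x.+1) = g (f x) by lia.
  have n1 : f x.+3 <> f x by move=> E; rewrite E in h1'; lia.
  have n2 : f x.+3 <> f x.+1 by move=> E; rewrite E in h1'; lia.
  have e3 : f x.+3 = (f x).+1 by lia.
  rewrite e3 in h1'.
  have : f x.-1 = f x \/ f x.-1 = f x.+1 \/ f x.-1 = (f x).+1 by lia.
  by case=> [E|[E|E]]; rewrite E in h0'; lia.
have fmono m n : N.+1 <= m <= n -> f m <= f n.
  elim: n => [|n IH] mn; first by lia.
  have [->//|mn'] : m = n.+1 \/ m <= n by lia.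
  by have := fmon n ltac:(lia); have := IH ltac:(lia); lia.
split.
  exists N.+1 => n Nn; split; first exact: fmon.
  have := fmono n (n + 3) ltac:(lia).
  rewrite leq_eqVlt => /predU1P[E|//].
  by have [_] := Nh n ltac:(lia); rewrite E; lia.
(* The first visit to [z.+1] after [N.+1] is entered from [z], so every late step of [g] is also a
   step of [g \o f]. *)
have above z : f N.+1 <= z -> exists2 x, N.+1 <= x & f x = z /\ f x.+1 = z.+1.
  move=> hz; have [n nz fn] := fbig (N.+1 + z.+1).
  have ex : exists n, (N.+1 <= n) && (f n == z.+1).
    have [y yP fy] := lipschitz_ivt lf (m := N.+1) (n := n) (c := z.+1)
      ltac:(lia) ltac:(lia).
    by exists y; apply/andP; split; lia.
  case: (ex_minnP ex) => m /andP[Nm /eqP fm] mmin.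
  have mN : m <> N.+1 by move=> E; rewrite E in fm; lia.
  exists m.-1; first by lia.
  have e : m.-1.+1 = m by lia.
  rewrite e fm; split=> //.
  have := lf m.-1; rewrite e fm => l.
  have fz : f m.-1 <> z.+1.
    move=> E; have := mmin m.-1; rewrite E eqxx andbT.
    by move=> /(_ ltac:(lia)); lia.
  by have := fmon m.-1 ltac:(lia); rewrite e; lia.
exists (f N.+1) => z hz.
have [x Nx [fx fx1]] := above z hz.
have [x' Nx' [fx' _]] := above (z + 3) ltac:(lia).
split; first by have [h _] := Nh x ltac:(lia); rewrite fx fx1 in h.
have xx' : x + 3 <= x'.
  have [h|h] := leqP x x'; last by have := fmono x' x ltac:(lia); lia.
  by have := lipschitz_le lf h; lia.
have [_ h] := Nh x ltac:(lia).
rewrite -fx'.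
by have := hmon (x + 3) x' ltac:(lia); rewrite fx in h; lia.
Qed.

(** The delay of [g \o f] at [n] is that of [f] at [n] plus that of [g] at [f n]. The second term
    decreases by a bounded amount at most, so it cannot hide a large increase of the first. *)
Lemma slow_left : climbing f -> slow (g \o f) -> slow f.
Proof.
move=> cf sgf k; have [C hC] := sgf k; rewrite /= in hC.
have [D hD] := climbing_quasi_le lf cf.
exists (C + 2 * D) => m n nm.
have [h|h] := leqP n m; first by have := lipschitz_le lf h; lia.
have := hC m n nm; have := hD m n ltac:(lia) => h1 h2.
have [h3|h3] := leqP (f m) (f n); first by have := lipschitz_le lg h3; lia.
by have := lipschitz_le lg (ltnW h3); lia.
Qed.

Lemma slow_right : climbing f -> slow (g \o f) -> slow g.
Proof.
move=> cf sgf k; have [c hc] := climbing_lower cf.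
have [C hC] := sgf (3 * k + 3 * c); rewrite /= in hC.
exists (C + 2 * f 0) => m n nm.
have [h|h] := leqP n m; first by have := lipschitz_le lg h; lia.
have fm := lipschitz_le lf (leq0n m).
(* Late enough for [f] to have reached [n], yet bounded linearly in [m], so that [hC] applies to [m]
   and [p]. *)
pose p := 3 * n + c.
have fp := hc p.
have np : n <= f p by rewrite /p in fp *; lia.
have := hC m p; rewrite {1}/p => /(_ ltac:(nia)) h1.
have h2 := lipschitz_le lg np.
have h3 := lipschitz_le lf (m := m) (n := p) ltac:(rewrite /p; lia).
have [h4|h4] := leqP (f m) m; first by have := lipschitz_le lg h4; lia.
by have := lipschitz_le lg (ltnW h4); lia.
Qed.

Lemma lagging_factors : lagging (g \o f) -> lagging f \/ lagging g.
Proof.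
move=> lgf; have [?|/existsNP[C hC]] := pselect (lagging f); first by left.
have [?|/existsNP[D hD]] := pselect (lagging g); first by right.
have [n /= hn] := lgf (C + D); exfalso.
have [h|h] := leqP n (f n + C); last by apply: hC; exists n.
have [h'|h'] := leqP (f n) (g (f n) + D); first by lia.
by apply: hD; exists (f n).
Qed.

End Factors.

(* With delay n - f n, this says that a two-sided multiple of g lags behind the identity
   at least as much as g does, up to a constant. *)
Lemma multiple_le x g y : lipschitz x -> lipschitz g -> lipschitz y ->
  climbing x -> slow g -> exists C, forall n, y (g (x n)) <= g n + C.
Proof.
move=> lx lg ly cx sg; have [c hc] := climbing_lower cx.
have [C hC] := sg (3 + c); exists (C + x 0 + y 0) => n.
have := hC (x n) n ltac:(have := hc n; nia).
have := lipschitz_le ly (leq0n (g (x n))); have := lipschitz_le lx (leq0n n); lia.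
Qed.

(** * Splitting the rests of a walk between two factors *)

(* Grows by 2 while d goes through 4j+2, 4j+3, 4j+4, and is constant on 4j, 4j+1, 4j+2. *)
Definition alternate d := 2 * (d %/ 4) + (d %% 4 - 2).

Lemma zigzag_walk_split g : zigzag_walk g -> climbing g -> lagging g ->
  exists u v, [/\ zigzag_walk u, zigzag_walk v, forall n, v (u n) = g n,
    lagging u & forall C, exists n, g n + C < u n].
Proof.
move=> [lg zg] cg Lg; have [N Ng] := cg; have [c hc] := climbing_lower cg.
(* A walk may move only at even delay, so [u] takes over rests in pairs, every other pair. The even
   offset [4 * N] keeps parities and makes [u] the identity up to [N], where [g] may still
   descend. *)
pose u n := n - alternate (n - g n - 4 * N).
have ustep n : (u n.+1 = (u n).+1 /\ odd (u n) = odd n \/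
               u n.+1 = u n /\ g n.+1 = g n).
  rewrite /u /alternate; have [h|h] := leqP n.+1 N.
    have -> : n - g n - 4 * N = 0 by lia.
    have -> : n.+1 - g n.+1 - 4 * N = 0 by lia.
    by left; rewrite !subn0.
  have [h1 _] := Ng n ltac:(lia); have := lg n.
  have [E|E] := eqVneq (g n.+1) (g n); last first.
    by have := zg n (fun e => negP E (introT eqP e)); left; split; lia.
  rewrite E; lia.
have lu : lipschitz u by move=> n; have := ustep n; lia.
have u0 : u 0 = 0 by [].
have umono m n : m <= n -> u m <= u n.
  elim: n => [|n IH] mn; first by have -> : m = 0 by lia.
  have [->//|mn'] : m = n.+1 \/ m <= n by lia.
  by have := ustep n; have := IH mn'; lia.
have uinv m n : m <= n -> u m = u n -> g m = g n.
  elim: n => [|n IH] mn; first by have -> : m = 0 by lia.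
  have [->//|mn'] : m = n.+1 \/ m <= n by lia.
  have := umono m n mn'; have := IH mn'; have := ustep n; lia.
have usur z : exists n, u n == z.
  have h : z <= u (3 * z + c).
    by rewrite /u /alternate; have := hc (3 * z + c); lia.
  by have [x _ <-] := lipschitz_ivt lu (leq0n _) (c := z) ltac:(rewrite u0; exact: h); exists x.
(* By [uinv], [g] is constant on the fibres of [u], so the choice of preimage is immaterial. *)
pose v z := g (ex_minn (usur z)).
have vu n : v (u n) = g n.
  by rewrite /v; case: ex_minnP => m /eqP um /(_ n (eqxx _)) mn; exact: uinv.
have vstep z : exists n, [/\ v z = g n, v z.+1 = g n.+1, u n = z & u n.+1 = z.+1].
  case: (ex_minnP (usur z.+1)) => -[|n] /eqP un nmin; first by rewrite u0 in un.
  have un' : u n = z.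
    have : u n <> z.+1 by move=> E; have := nmin n; rewrite E eqxx ltnn => /(_ isT).
    by have := ustep n; lia.
  by exists n; rewrite -vu un' -vu un.
exists u, v; split=> //.
- by split=> // n nn; have := ustep n; lia.
- split=> z; have [n [-> -> un un1]] := vstep z; first exact: lg.
  by move=> /zg ->; have := ustep n; lia.
(* Each factor receives about half of the delay of [g], whence [2 * C]. *)
- by move=> C; have [n hn] := Lg (2 * C + 4 * N + 10); exists n; rewrite /u /alternate; lia.
- by move=> C; have [n hn] := Lg (2 * C + 4 * N + 10); exists n; rewrite /u /alternate; lia.
Qed.

(** * A walk with logarithmic delay *)

Local Notation lg := (trunc_log 2).

Lemma trunc_log2_addn2 n : lg n.+2 <= (lg n).+1.
Proof.
case: n => [|[|n]] //; rewrite -trunc_log2_double //.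
by apply: leq_trunc_log; lia.
Qed.

Lemma trunc_log2_mulX k n : 0 < n -> lg (2 ^ k * n) = k + lg n.
Proof.
move=> n0; elim: k => [|k IH]; first by rewrite mul1n.
by rewrite expnS -mulnA mul2n trunc_log2_double ?IH // muln_gt0 expn_gt0.
Qed.

(** With delay [lg n + lg n.+1], the walk rests exactly at times [2 ^ k - 2] and [2 ^ k - 1] for
    [k > 0]. When it moves, both logarithms agree and the delay is even. Multiplying [n] by a
    constant changes the delay by a bounded amount. *)
Lemma slow_walk_exists : exists f,
  [/\ zigzag_walk f, climbing f, slow f & lagging f].
Proof.
pose p n := lg n + lg n.+1.
have mono m n : m <= n -> lg m <= lg n by exact: leq_trunc_log.
have pS n : p n.+1 + lg n = p n + lg n.+2 by rewrite /p; lia.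
have ple n : p n <= n.
  elim: n => [//|n IH]; have := pS n; have := trunc_log2_addn2 n; lia.
exists (fun n => n - p n); split.
- split=> n; have := ple n; have := ple n.+1; have := pS n.
    have := trunc_log2_addn2 n; have := mono n n.+2; lia.
  move=> h1 h2 h3 h4.
  have := trunc_log2_addn2 n; have := mono n n.+1; have := mono n.+1 n.+2.
  rewrite /p in h1 h2 h3 h4 *; lia.
- exists 4 => n n4; have := ple n; have := ple n.+1; have := ple (n + 3); have := pS n.
  have := trunc_log2_addn2 n; have := mono n n.+1; have := mono n n.+2.
  have : lg (n + 4) <= (lg n).+1.
    by rewrite -trunc_log2_double ?(ltn_trans _ n4) //; apply: mono; rewrite -addnn leq_add2l.
  have := mono (n + 3) (n + 4); rewrite /p -(addnS n 3); lia.
- move=> k; exists (2 * k + 3) => m n nkm.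
  have : lg n.+1 <= k.+1 + lg m.+1.
    rewrite -trunc_log2_mulX //; apply: mono.
    by have := @ltn_expl 2 k.+1 isT; nia.
  have := mono n n.+1; have := ple n; have := ple m.
  have := mono m.+1 m.+2; have := trunc_log2_addn2 m.
  rewrite /p; lia.
- move=> C; exists (2 ^ C.+1); have := ple (2 ^ C.+1).
  by rewrite /p trunc_expnK //; lia.
Qed.

(** * Transfer between [posnat] and [nat] *)

Definition pos_succ (n : nat) : posnat := exist (fun n => 0 < n) n.+1 isT.

Definition to_nat_map (a : posnat -> posnat) n := (val (a (pos_succ n))).-1.

Definition of_nat_map (f : nat -> nat) (x : posnat) := pos_succ (f (val x).-1).

Lemma pos_succK (x : posnat) : pos_succ (val x).-1 = x.
Proof. by apply/val_inj; case: x => -[]. Qed.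

Lemma to_nat_mapK : cancel of_nat_map to_nat_map.
Proof. by []. Qed.

Lemma to_nat_map_comp a b : to_nat_map (a \; b) = to_nat_map b \o to_nat_map a.
Proof. by apply/funext => n; rewrite /to_nat_map /= pos_succK. Qed.

(** The points [n] and [n.+1] are comparable in a direction fixed by the parity of [n]; their images
    coincide or are neighbours in the same direction. *)
Lemma FN_zigzag_walk a : FN a -> zigzag_walk (to_nat_map a).
Proof.
move=> Fa.
have step n : let f := to_nat_map a in
    f n.+1 = f n \/ (f n.+1 = (f n).+1 \/ f n = (f n.+1).+1) /\ odd (f n) = odd n.
  rewrite /to_nat_map /=.
  have := Fa (pos_succ n) (pos_succ n.+1); have := Fa (pos_succ n.+1) (pos_succ n).
  rewrite /zigzag_le !zigzag_ltE /= -!(inj_eq val_inj) /=.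
  have := valP (a (pos_succ n)); have := valP (a (pos_succ n.+1)); lia.
by split=> n; have := step n => /=; lia.
Qed.

Lemma zigzag_walk_FN f : zigzag_walk f -> FN (of_nat_map f).
Proof.
move=> [lf zf] [[|x] x0] [[|y] y0] //.
rewrite /zigzag_le !zigzag_ltE -!(inj_eq val_inj) /=.
have := lf x; have := lf y; have := zf x; have := zf y.
have [->|] := eqVneq x y; first by lia.
have [->|] := eqVneq x y.+1; first by lia.
have [->|] := eqVneq y x.+1; first by lia.
lia.
Qed.

Lemma generated_subsemigroup G : G `<=` FN -> subsemigroup (generated G).
Proof.
move=> GF; split; first by move=> a; apply; split=> //; exact: subsemigroup_FN.
by move=> a b Ga Gb S [Ss GS]; case: (Ss) => _; apply; [apply: Ga | apply: Gb].
Qed.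

(** * Redundancy of a slow lagging generator *)

Theorem theorem2p10 :
  ~ exists G : set (posnat -> posnat), minimal_generating_set G.
Proof.
move=> [G [[GF Ggen] Gmin]].
pose K (a : posnat -> posnat) :=
  [/\ climbing (to_nat_map a), slow (to_nat_map a) & lagging (to_nat_map a)].
have lip a : FN a -> lipschitz (to_nat_map a) by case/FN_zigzag_walk.
have Ffac a b : FN a -> FN b -> climbing (to_nat_map (a \; b)) ->
    climbing (to_nat_map a) /\ climbing (to_nat_map b).
  by move=> Fa Fb; rewrite to_nat_map_comp; apply: climbing_factors; exact: lip.
have [g Gg [cg sg Lg]] : exists2 g, G g & K g.
  have [f [zf cf sf Lf]] := slow_walk_exists.
  have : generated G (of_nat_map f) by rewrite Ggen; exact: zigzag_walk_FN.
  (* Induction on products: if a product satisfies [K], so does one of its factors. *)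
  move=> /(_ [set a | FN a /\ (K a -> exists2 g, G g & K g)]) [].
  - split; last by move=> a Ga; split; [exact: GF | exists a].
    split=> [a []//|a b [Fa Ka] [Fb Kb]]; split.
      by have [_] := subsemigroup_FN; apply.
    move=> [cab sab lab]; have [ca cb] := Ffac _ _ Fa Fb cab.
    rewrite to_nat_map_comp in sab lab.
    have [la lb] := (lip _ Fa, lip _ Fb).
    have [ha|hb] := lagging_factors lab.
      by apply: Ka; split=> //; exact: slow_left sab.
    by apply: Kb; split=> //; exact: slow_right sab.
  - by move=> _; apply; rewrite /K to_nat_mapK.
have Fg := GF _ Gg.
have [u0 [v0 [zu zv vu Lu gu]]] := zigzag_walk_split (FN_zigzag_walk Fg) cg Lg.
pose u := of_nat_map u0; pose v := of_nat_map v0.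
have [Fu Fv] : FN u /\ FN v by split; exact: zigzag_walk_FN.
have guv : g = u \; v.
  by apply/funext => x; rewrite /= /u /v /of_nat_map /= vu /to_nat_map !pos_succK.
have [cu cv] : climbing u0 /\ climbing v0 by apply: (Ffac u v) => //; rewrite -guv.
pose G' := G `\ g.
have G'F : G' `<=` FN by move=> a [/GF].
(* A product of generators either avoids [g] or is a two-sided multiple of it, possibly with
   identity cofactors. *)
have dich a : FN a ->
    generated G' a \/ exists x y, [/\ FN x, FN y & a = x \; g \; y].
  have [_ FNM] := subsemigroup_FN.
  rewrite -{1}Ggen => /(_ [set a | FN a /\ (generated G' a \/
    exists x y, [/\ FN x, FN y & a = x \; g \; y])]) []; last by [].
  split; last first.
    move=> a' Ga'; split; first exact: GF.
    have [->|ag] := pselect (a' = g); first by right; exists id, id; split.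
    by left=> S [_]; apply; split.
  split=> [b []//|b c [Fb Hb] [Fc Hc]]; split; first exact: FNM.
  case: Hb => [Hb|[x [y [Fx Fy ->]]]]; last first.
    by right; exists x, (y \; c); split=> //; exact: FNM.
  case: Hc => [Hc|[x [y [Fx Fy ->]]]]; last first.
    by right; exists (b \; x), y; split=> //; exact: FNM.
  by left; have [_] := generated_subsemigroup G'F; apply.
have bound a : FN a -> climbing (to_nat_map a) -> ~ generated G' a ->
    exists C, forall n, to_nat_map a n <= to_nat_map g n + C.
  move=> Fa ca; case: (dich a Fa) => [//|[x [y [Fx Fy E]]]] _.
  have cx : climbing (to_nat_map x).
    have [_ FNM] := subsemigroup_FN.
    by have [] := Ffac x (g \; y) Fx (FNM _ _ Fg Fy); first by rewrite -E.
  have [C hC] := multiple_le (lip _ Fx) (lip _ Fg) (lip _ Fy) cx sg.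
  exists C => n.
  by rewrite E (to_nat_map_comp x (g \; y)) (to_nat_map_comp g y); exact: hC.
have Gu : generated G' u.
  apply: contrapT => /(bound _ Fu cu)[C hC].
  by have [n] := gu C; have := hC n; rewrite to_nat_mapK; lia.
have Gv : generated G' v.
  apply: contrapT => /(bound _ Fv cv)[C hC].
  (* At [u0 n] the bound reads [g n <= g (u0 n) + C], with [g] read on [nat]. As [n] is at most
     linear in [u0 n], slowness of [g] then bounds [n - u0 n], against [Lu]. *)
  have [c hc] := climbing_lower cu; have [D hD] := sg (3 + c).
  have [n] := Lu (C + D); have := hD (u0 n) n ltac:(have := hc n; nia).
  by have := hC (u0 n); rewrite to_nat_mapK vu; lia.
have [G'F' G'M] := generated_subsemigroup G'F.
apply: (Gmin G').
  by split=> [a []//|/(_ g Gg)[_]]; apply.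
apply/seteqP; split=> //; rewrite -[X in X `<=` _]Ggen => a; apply; split=> //.
move=> b Gb; have [->|bg] := pselect (b = g); last by move=> S [_]; apply; split.
by rewrite guv; exact: G'M.
Qed.
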